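(* Let $g$ and $h$ be normalized arithmetic functions with $h$ non-vanishing, and let $1 \le m < n$ be integers. Then $$A_{n,m}^{g,h} = \sum_{\mu \vdash n-m} \mathcal{G}(\mu)\, \mathcal{H}(\mu,n),$$ where the sum runs over all partitions $\mu$ of $n-m$.
   Context: An arithmetic function is a map $f:\mathbb{N}=\{1,2,\dots\}\to\mathbb{C}$; it is normalized if $f(1)=1$. Let $g,h$ be normalized arithmetic functions with $h(n)\neq 0$ for all $n\ge1$, and put $h(0):=0$. Define polynomials by $P_0^{g,h}(x):=1$ and, for $n\ge1$, $P_n^{g,h}(x):=\frac{x}{h(n)}\sum_{k=1}^{n} g(k)\,P_{n-k}^{g,h}(x)$. Let $H(n):=\prod_{k=1}^n h(k)$, $H(0):=1$. Write $H(n)\,P_n^{g,h}(x)=\sum_{m=0}^{n} A_{n,m}^{g,h}x^m$ (so $A_{n,0}^{g,h}=0$ for $n\ge1$). For integers $m\ge 0$ and $n$ put $h_m(n):=\prod_{k=0}^{m-1}h(n-k)$. A composition $\mu=(\mu_1,\dots,\mu_r)$ is a finite sequence of positive integers, with length $\ell(\mu)=r$ and size $|\mu|=\sum_i\mu_i$; the empty composition $\varepsilon$ has $\ell(\varepsilon)=|\varepsilon|=0$. A partition is a composition with $\mu_1\ge\dots\ge\mu_r$; $\mu\vdash N$ means $\mu$ is a partition of size $N$. The symmetric group $S_r$ acts on compositions of length $r$ by permuting parts; $\mathrm{Orb}(\mu)$ denotes the set of distinct compositions obtained by permuting the parts of $\mu$. For a partition $\mu$, $\mathcal{G}(\mu):=\prod_{k=1}^{\ell(\mu)}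 g(\mu_k+1)$. Define $H(\mu,n)$ for compositions $\mu$ (including $\varepsilon$) and integers $n\ge0$ by induction on length: $H(\varepsilon,n):=1$; if $\mu=(\mu_1,\dots,\mu_{r+1})$ has length $r+1\ge1$, then for $n\ge|\mu|+\ell(\mu)$, $$H(\mu,n):=\sum_{k=|\mu|+\ell(\mu)-1}^{n-1} h_{\mu_{r+1}}(k)\,H\big((\mu_1,\dots,\mu_r),\,k-\mu_{r+1}\big),$$ and $H(\mu,n):=0$ if $n<|\mu|+\ell(\mu)$. Finally $\mathcal{H}(\mu,n):=\sum_{\lambda\in\mathrm{Orb}(\mu)}H(\lambda,n)$. *)

(* Defs.v *)
From HB Require Import structures.
From mathcomp Require Import all_boot all_order all_algebra.
From mathcomp Require Import reals.
From mathcomp Require Import complex zify.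

Set Implicit Arguments.
Unset Strict Implicit.
Unset Printing Implicit Defensive.

Import GRing.Theory.
Local Open Scope ring_scope.

(* An arithmetic function {1, 2, ...} -> F is encoded as a map nat -> F whose
   value at 0 is never used: g and h are only read at positive arguments, and
   [ext0 h] is h with the convention h(0) := 0. *)

Definition normalized (F : nzRingType) (f : nat -> F) : Prop := f 1%N = 1.

Definition nonvanishing (F : nzRingType) (f : nat -> F) : Prop :=
  forall n : nat, (1 <= n)%N -> f n != 0.

Definition ext0 (F : nzRingType) (h : nat -> F) (n : nat) : F :=
  if n is 0%N then 0 else h n.

Section Polynomials.
Variables (F : fieldType) (g h : nat -> F).

(* [Ptable n] is the list [:: P_n; P_{n-1}; ...; P_0]; see [P_0] and [P_rec]. *)
Fixpoint Ptable (n : nat) : seq {poly F} :=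
  if n is n'.+1 then
    let s := Ptable n' in
    ((h n)^-1 *: 'X) * (\sum_(1 <= k < n.+1) g k *: s`_k.-1) :: s
  else [:: 1].

Definition P (n : nat) : {poly F} := (Ptable n)`_0.

Lemma nth_Ptable (n k : nat) : (k <= n)%N -> (Ptable n)`_k = P (n - k).
Proof.
elim: n k => [|n IHn] [|k] // kn.
by rewrite subSS -IHn.
Qed.

Lemma P_0 : P 0 = 1.
Proof. by []. Qed.

Lemma P_rec (n : nat) : (1 <= n)%N ->
  P n = ((h n)^-1 *: 'X) * (\sum_(1 <= k < n.+1) g k *: P (n - k)).
Proof.
case: n => // n _; rewrite {1}/P /=; congr (_ * _).
apply: eq_big_nat => -[//|k] /= kn; rewrite nth_Ptable //.
Qed.

Definition Hprod (n : nat) : F := \prod_(1 <= k < n.+1) h k.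

Definition A (n m : nat) : F := (Hprod n *: P n)`_m.

Lemma size_P (n : nat) : (size (P n) <= n.+1)%N.
Proof.
elim/ltn_ind: n => -[|n] IHn; first by rewrite P_0 size_poly1.
rewrite P_rec // -scalerAl (leq_trans (size_scale_leq _ _)) //.
rewrite mulrC (leq_trans (size_polyMleq _ _)) // size_polyX addn2 /= ltnS.
rewrite (leq_trans (size_sum _ _ _)) //; apply/bigmax_leqP_seq => k.
rewrite mem_index_iota => /andP[k1 kn] _.
rewrite (leq_trans (size_scale_leq _ _)) // (leq_trans (IHn _ _)) //; lia.
Qed.

Lemma A_expansion (n : nat) :
  Hprod n *: P n = \sum_(0 <= m < n.+1) A n m *: 'X^m.
Proof.
rewrite big_mkord -poly_def; apply/polyP => m; rewrite coef_poly ltnS.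
case: leqP => // ltnm; rewrite nth_default //.
by rewrite (leq_trans (size_scale_leq _ _)) // (leq_trans (size_P n)).
Qed.

End Polynomials.

(* Compositions are sequences of naturals with positive entries, of length
   [size mu] and size [sumn mu]. *)
Definition is_composition (mu : seq nat) : bool := all (leq 1) mu.

Definition is_partition (mu : seq nat) : bool :=
  is_composition mu && sorted geq mu.

(* A partition of N has at most N parts, each at most N, hence is found among
   the sequences of length at most N over 'I_N.+1; see [mem_partitions]. *)
Definition partitions (N : nat) : seq (seq nat) :=
  [seq mu <- [seq map val s | s : N.-bseq 'I_N.+1]
     | is_partition mu & sumn mu == N].

Lemma mem_partitions (N : nat) (mu : seq nat) :
  (mu \in partitions N) = is_partition mu && (sumn mu == N).
Proof.
rewrite mem_filter /=; case: (boolP (is_partition mu && _)) => //=.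
move=> /andP[/andP[/allP mu_pos _] /eqP sumN].
have szN : (size mu <= N)%N.
  rewrite -sumN; elim: mu mu_pos {sumN} => //= p mu IHmu mu_pos.
  have p1 := mu_pos p (mem_head _ _).
  suff: (size mu <= sumn mu)%N by lia.
  by apply: IHmu => q qmu; apply: mu_pos; rewrite inE qmu orbT.
have leN p : p \in mu -> (p <= N)%N.
  rewrite -sumN; elim: mu {mu_pos sumN szN} => //= q mu IHmu.
  by rewrite inE => /predU1P[->|/IHmu]; lia.
have sz : (size (map (@inord N) mu) <= N)%N by rewrite size_map.
apply/mapP; exists (Bseq sz); first by rewrite mem_enum.
rewrite /= -map_comp map_id_in // => p /leN pN /=.
by rewrite inordK.
Qed.

Lemma partitions_uniq (N : nat) : uniq (partitions N).
Proof.
apply/filter_uniq; rewrite map_inj_uniq ?enum_uniq //.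
by move=> s t /(inj_map val_inj) /val_inj.
Qed.

Definition calG (F : fieldType) (g : nat -> F) (mu : seq nat) : F :=
  \prod_(p <- mu) g p.+1.

Section CompositionSums.
Variables (F : fieldType) (h : nat -> F).

(* h_m(n) = h(n) h(n-1) ... h(n-m+1). For m > n the product contains the factor
   h(0) = 0, so the truncation of n - k at 0 has no effect on its value. *)
Definition hfall (m n : nat) : F := \prod_(0 <= k < m) ext0 h (n - k).

(* H(mu, n) is defined by recursion on the last part of mu, hence structurally
   on the reversed sequence; see [Hcomp_nil] and [Hcomp_rcons]. *)
Fixpoint Hcomp_rev (s : seq nat) (n : nat) : F :=
  if s is p :: s' then
    let b := (sumn s + size s)%N in
    if (b <= n)%N then
      \sum_(b.-1 <= k < n) hfall p k * Hcomp_rev s' (k - p)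
    else 0
  else 1.

Definition Hcomp (mu : seq nat) (n : nat) : F := Hcomp_rev (rev mu) n.

Lemma Hcomp_nil (n : nat) : Hcomp [::] n = 1.
Proof. by []. Qed.

Lemma Hcomp_rcons (mu : seq nat) (p n : nat) :
  let b := (sumn (rcons mu p) + size (rcons mu p))%N in
  Hcomp (rcons mu p) n =
    if (b <= n)%N then \sum_(b.-1 <= k < n) hfall p k * Hcomp mu (k - p) else 0.
Proof.
rewrite /Hcomp rev_rcons /= sumn_rcons size_rcons sumn_rev size_rev.
by rewrite [(sumn mu + p)%N]addnC.
Qed.

(* [permutations mu] lists the distinct rearrangements of mu, i.e. Orb(mu). *)
Definition calH (mu : seq nat) (n : nat) : F :=
  \sum_(lambda <- permutations mu) Hcomp lambda n.

End CompositionSums.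

(* Main.v *)
Require Import Defs.
From mathcomp Require Import all_boot all_order all_algebra.
From mathcomp Require Import reals.
From mathcomp Require Import complex.
From mathcomp Require Import zify.

Import GRing.Theory.
Local Open Scope ring_scope.

(** Splitting off the last part [p] of a composition and the last term of the
    sum defining [H] gives
    [H(mu p, n+1) = H(mu p, n) + h_p(n) H(mu, n-p)].
    Weighting by [g] and summing over all compositions of [N = n - m], this is
    exactly the recursion
    [A_(n+1,m+1) = A_(n,m) + \sum_(p >= 1) g(p+1) h_p(n) A_(n-p,m)]
    that the definition of [P_n] yields after clearing denominators.  Grouping
    the compositions by their underlying partition gives the theorem. *)

(** Built as the concatenation of the orbits of the partitions of [N], so that grouping a sum by
    partitions is immediate; [mem_compositions] recovers the intrinsic description. *)
Definition compositions (N : nat) : seq (seq nat) :=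
  [seq la | mu <- partitions N, la <- permutations mu].

Lemma is_composition_rcons (mu : seq nat) (p : nat) :
  is_composition (rcons mu p) = (1 <= p)%N && is_composition mu.
Proof. exact: all_rcons. Qed.

Lemma mem_compositions (N : nat) (la : seq nat) :
  (la \in compositions N) = is_composition la && (sumn la == N).
Proof.
apply/allpairsPdep/idP => [[mu [nu [+ + ->]]]|/andP[la_pos sum_la]].
  rewrite mem_partitions mem_permutations perm_sym.
  move=> /andP[/andP[mu_pos _] mu_sum] mu_nu; rewrite /is_composition -(perm_all _ mu_nu) -/(is_composition mu).
  by rewrite mu_pos -(perm_sumn mu_nu).
have sort_la := permEl (perm_sort geq la).
exists (sort geq la), la; split=> //; last by rewrite mem_permutations perm_sym.
rewrite mem_partitions (perm_sumn sort_la) sum_la andbT /is_partition.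
rewrite /is_composition (perm_all _ sort_la) [all _ _]la_pos.
by apply: sort_sorted => x y; exact: leq_total.
Qed.

(** Distinct partitions have disjoint orbits: two weakly decreasing sequences that are permutations
    of each other coincide. *)
Lemma compositions_uniq (N : nat) : uniq (compositions N).
Proof.
apply: allpairs_uniq_dep; first exact: partitions_uniq.
  by move=> mu _; exact: permutations_uniq.
move=> [mu1 la1] [mu2 la2] /allpairsPdep[nu1 [ka1 [+ + [-> ->]]]].
move=> + + /allpairsPdep[nu2 [ka2 [+ + [-> ->]]]] /= eq_ka.
rewrite !mem_partitions !mem_permutations -eq_ka.
move=> /andP[/andP[_ s1] _] p1 /andP[/andP[_ s2] _] p2.
have -> // : nu1 = nu2.
apply: (sorted_eq (leT := geq)) => //.
- by move=> x y z /= yx zy; exact: leq_trans yx.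
- by move=> x y; rewrite andbC -eqn_leq => /eqP.
- by rewrite perm_sym in p1; exact: perm_trans p1 p2.
Qed.

Lemma perm_compositions_rcons (N : nat) : (0 < N)%N ->
  perm_eq (compositions N)
    [seq rcons mu p | p <- index_iota 1 N.+1, mu <- compositions (N - p)].
Proof.
move=> N_gt0; apply: uniq_perm; first exact: compositions_uniq.
  apply: allpairs_uniq_dep; first exact: iota_uniq.
    by move=> p _; exact: compositions_uniq.
  by move=> [p mu] [q nu] _ _ /= /rcons_inj[-> ->].
move=> la; rewrite mem_compositions; apply/idP/allpairsPdep => /=.
  case/lastP: la => [|mu p]; first by move/eqP=> N0; rewrite -N0 in N_gt0.
  rewrite is_composition_rcons sumn_rcons => /andP[/andP[p_gt0 mu_pos] /eqP sum_mu].
  exists p, mu; rewrite mem_index_iota mem_compositions mu_pos.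
  by split=> //; lia.
move=> [p [mu [+ + ->]]]; rewrite mem_index_iota mem_compositions.
rewrite is_composition_rcons sumn_rcons => /andP[-> pN] /andP[-> /eqP ->] /=.
by lia.
Qed.

Section Recursions.
Variables (F : fieldType) (g h : nat -> F).

Lemma hfall0 (n : nat) : hfall h 0 n = 1.
Proof. by rewrite /hfall big_geq. Qed.

Lemma hfallS (p n : nat) : hfall h p.+1 n = hfall h p n * ext0 h (n - p).
Proof. by rewrite /hfall big_nat_recr. Qed.

(** The factor of index [n] is h(0) = 0. This kills the terms in which the natural subtraction
    [n - p] is truncated. *)
Lemma hfall_eq0 (p n : nat) : (n < p)%N -> hfall h p n = 0.
Proof.
elim: p => // p IHp; rewrite ltnS leq_eqVlt hfallS => /predU1P[->|/IHp ->].
  by rewrite subnn mulr0.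
by rewrite mul0r.
Qed.

Lemma Hprod_hfall (p n : nat) : (p <= n)%N ->
  Hprod h n = hfall h p n * Hprod h (n - p).
Proof.
elim: p => [|p IHp] pn; first by rewrite hfall0 mul1r subn0.
rewrite IHp 1?ltnW // hfallS -mulrA -subnSK //=; congr (_ * _).
by rewrite /Hprod big_nat_recr //= mulrC.
Qed.

Lemma Hcomp_eq0 (mu : seq nat) (n : nat) :
  mu != [::] -> (n < sumn mu + size mu)%N -> Hcomp h mu n = 0.
Proof. by case/lastP: mu => // mu p _; rewrite Hcomp_rcons ltnNge => /negbTE ->. Qed.

Lemma Hcomp_rconsS (mu : seq nat) (p n : nat) :
  Hcomp h (rcons mu p) n.+1 =
    Hcomp h (rcons mu p) n + hfall h p n * Hcomp h mu (n - p).
Proof.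
rewrite !Hcomp_rcons sumn_rcons size_rcons addnS /=.
case: (ltngtP (sumn mu + p + size mu) n) => [lt_n|gt_n|eq_n].
- by rewrite ltnS ltnW // big_nat_recr //= ltnW.
(* Below the threshold both values of [Hcomp] at [rcons mu p] are 0, so the extra term has to
   vanish. If [n < p], [hfall] does; otherwise [n - p] lies below the threshold of [mu], which
   forces [mu] to be nonempty. *)
- rewrite ltnS leqNgt gt_n /= add0r.
  have [/hfall_eq0->|pn] := ltnP n p; first by rewrite mul0r.
  rewrite Hcomp_eq0 ?mulr0 //; last by lia.
  by case: mu gt_n => //=; lia.
- by rewrite eq_n leqnn big_nat1 add0r.
Qed.

Definition composition_sum (N n : nat) : F :=
  \sum_(la <- compositions N) calG g la * Hcomp h la n.

Lemma calG_perm (mu nu : seq nat) : perm_eq mu nu -> calG g mu = calG g nu.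
Proof. exact: perm_big. Qed.

Lemma calG_rcons (mu : seq nat) (p : nat) : calG g (rcons mu p) = g p.+1 * calG g mu.
Proof. by rewrite /calG big_rcons mulrC. Qed.

Lemma composition_sumE (N n : nat) :
  composition_sum N n = \sum_(mu <- partitions N) calG g mu * calH h mu n.
Proof.
rewrite /composition_sum big_allpairs_dep; apply: eq_bigr => mu _.
rewrite /calH mulr_sumr; apply: eq_big_seq => la.
by rewrite mem_permutations => /calG_perm ->.
Qed.

Lemma composition_sum0 (n : nat) : composition_sum 0 n = 1.
Proof.
rewrite /composition_sum (perm_big [:: [::]]) /=.
  by rewrite big_seq1 /calG big_nil mul1r.
apply: uniq_perm => //; first exact: compositions_uniq.
by case=> [|[|p] s]; rewrite mem_compositions inE //= andbF.
Qed.

(** A composition of [n.+1] has at least one part, so its threshold, size plus length, exceeds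
    [n.+1]. This matches [AS0]. *)
Lemma composition_sum_diag (n : nat) : composition_sum n.+1 n.+1 = 0.
Proof.
rewrite /composition_sum big_seq big1 // => -[|p s]; rewrite mem_compositions //.
by case/andP=> _ /eqP sum_s; rewrite Hcomp_eq0 ?mulr0 // sum_s /=; lia.
Qed.

Lemma composition_sumS (N n : nat) :
  composition_sum N n.+1 = composition_sum N n +
    \sum_(1 <= p < N.+1) g p.+1 * hfall h p n * composition_sum (N - p) (n - p).
Proof.
case: N => [|N]; first by rewrite !composition_sum0 big_geq // addr0.
rewrite /composition_sum !(perm_big _ (perm_compositions_rcons N.+1 isT)).
rewrite !big_allpairs_dep -big_split; apply: eq_bigr => p _ /=.
rewrite mulr_sumr -big_split; apply: eq_bigr => mu _ /=.
by rewrite Hcomp_rconsS calG_rcons mulrDr mulrACA.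
Qed.

Lemma A_eq0 (n m : nat) : (n < m)%N -> A g h n m = 0.
Proof. by move=> nm; rewrite /A coefZ nth_default ?mulr0 // (leq_trans (size_P _ _ _)). Qed.

Lemma A00 : A g h 0 0 = 1.
Proof. by rewrite /A /Hprod big_geq // P_0 scale1r coef1. Qed.

Lemma AS0 (n : nat) : A g h n.+1 0 = 0.
Proof. by rewrite /A P_rec // -scalerAl !coefZ coefXM !mulr0. Qed.

Hypothesis h_neq0 : nonvanishing h.

(** In [Hprod n.+1] times [P_rec], the factor h(n+1) cancels; the remaining [Hprod n] splits as
    [hfall h p n] times the normalization of P_(n-p), where p = k - 1. *)
Lemma A_SS (n m : nat) :
  A g h n.+1 m.+1 = \sum_(0 <= p < n.+1) g p.+1 * hfall h p n * A g h (n - p) m.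
Proof.
rewrite /A P_rec // -scalerAl !coefZ coefXM /= coef_sum mulrA.
have -> : Hprod h n.+1 / h n.+1 = Hprod h n.
  by rewrite /Hprod big_nat_recr //= mulfK // h_neq0.
rewrite big_add1 /= mulr_sumr; apply: eq_big_nat => p /andP[_ pn].
by rewrite subSS !coefZ (Hprod_hfall p n) // mulrACA [hfall _ _ _ * _]mulrC.
Qed.

Hypothesis g1 : normalized g.

Lemma A_composition_sum (n m : nat) : (m <= n)%N ->
  A g h n m = composition_sum (n - m) n.
Proof.
elim/ltn_ind: n m => -[|n] IHn [|m] // mn; first by rewrite A00 composition_sum0.
  by rewrite AS0 composition_sum_diag.
(* The term [p = 0] of [A_SS] has coefficient g(1) = 1 and gives the first summand of
   [composition_sumS]. *)
rewrite A_SS subSS composition_sumS big_nat_recl //.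
rewrite g1 hfall0 !mul1r subn0 IHn //; congr (_ + _).
(* The index is now shifted by one. The sum from [A_SS] runs up to [n], the other only up to
   [n - m]; the surplus terms contain the coefficient of x^m in a polynomial of degree below m. *)
rewrite [RHS]big_add1 /= (big_cat_nat (n := n - m)) ?leq_subr //=.
rewrite [X in _ + X]big_nat [X in _ + X]big1 ?addr0; last first.
  by move=> p /andP[lep ltp]; rewrite A_eq0 ?mulr0 //; lia.
apply: eq_big_nat => p /andP[_ ltp]; rewrite IHn; [|lia..].
by congr (_ * composition_sum _ _); lia.
Qed.

End Recursions.

Theorem mainTheorem1 (R : realType) (g h : nat -> R[i])
    (hg : normalized g) (hh : normalized h) (hnz : nonvanishing h)
    (m n : nat) (hm : (1 <= m)%N) (hmn : (m < n)%N) :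
  A g h n m = \sum_(mu <- partitions (n - m)) calG g mu * calH h mu n.
Proof. by rewrite A_composition_sum ?composition_sumE // ltnW. Qed.
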